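(* Let $\mathcal{F}\subseteq\{0',1,{}^{-1},\pi,\bar\pi,/,\backslash\}$, i.e., $\mathcal{F}$ contains neither complement nor set difference, and let $k$ be a natural number. For any marked structures $\mathbf{G}_1=(G_1,a_1,b_1)$ and $\mathbf{G}_2=(G_2,a_2,b_2)$, $\mathbf{G}_1$ is $(\mathcal{F},k)$-similar to $\mathbf{G}_2$ if and only if $\mathbf{G}_1\sqsubseteq^{\mathcal{F}}_k\mathbf{G}_2$.
   Context: Fix a finite set $\Lambda$ of relation names. A structure is $G=(V,(R^G)_{R\in\Lambda})$ with each $R^G\subseteq V\times V$. Expressions are built from relation names and constants $0,1,0',1'$ using $\cup,\cap,\circ,/,\backslash,{}^{-1},\pi_1,\pi_2,\bar\pi_1,\bar\pi_2$ (and possibly ${}^c,-$), with semantics on $G$ (node set $V$): $R(G)=R^G$, $0(G)=\emptyset$, $1(G)=V^2$, $0'(G)=\{(s,t)\in V^2:s\ne t\}$, $1'(G)=\{(s,s):s\in V\}$; set operations for $\cup,\cap$; $(e_1\circ e_2)(G)=\{(s,t):\exists v\,((s,v)\in e_1(G)\wedge(v,t)\in e_2(G))\}$; $e^{-1}(G)=\{(s,t):(t,s)\in e(G)\}$; $\pi_1(e)(G)=\{(s,s):\exists t\,(s,t)\in e(G)\}$, $\pi_2(e)(G)=\{(s,s):\exists t\,(t,s)\in e(G)\}$; $\bar\pi_1(e)(G)=\{(s,s):s\in V,\neg\exists t\,(s,t)\in e(G)\}$, $\bar\pi_2(e)(G)=\{(s,s):s\in V,\neg\exists t\,(t,s)\in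 e(G)\}$; $(e_1/e_2)(G)=\{(s,t)\in V^2:\forall v((t,v)\in e_2(G)\to(s,v)\in e_1(G))\}$; $(e_1\backslash e_2)(G)=\{(s,t)\in V^2:\forall v((v,s)\in e_1(G)\to(v,t)\in e_2(G))\}$. $\mathcal{C}(\mathcal{F})$: expressions built from relation names, $0$, $1'$, constants in $\mathcal{F}$ using $\circ,\cup,\cap$ and operations in $\mathcal{F}$ ($\pi$ = both projections, $\bar\pi$ = both coprojections). Degree: atoms/constants $0$; $\cup,\cap$: max; ${}^{-1}$: unchanged; $\circ,/,\backslash$: $1+\max$; $\pi_i,\bar\pi_i$: $+1$. $\mathcal{C}(\mathcal{F})_k$: degree $\le k$. $\mathrm{paths}^{\mathcal{F}}_k(G)$: let $E_G=\bigcup_R R^G$; $\mathrm{paths}_k(G)$ = pairs joined by a directed path of length $\le 2^k$ (length $0$ allowed), $\mathrm{upaths}_k(G)$ = same in the undirected version. 1 is present at degree 0 if $\mathcal{F}$ contains $1$ or $0'$; at degree 1 if not at degree 0 and $\mathcal{F}$ contains $/$ or $\backslash$; absent otherwise. If absent: $\mathrm{paths}^{\mathcal{F}}_k(G)=\mathrm{paths}_k(G)$ if ${}^{-1}\notin\mathcal{F}$, $=\mathrm{upaths}_k(G)$ if ${}^{-1}\in\mathcal{F}$; if at degree 1: as in the absent case for $k=0$, $V^2$ for $k>0$; if at degree 0: $V^2$. $(G_1,a_1,b_1)\sqsubseteq^{\mathcal{F}}_k(G_2,a_2,b_2)$ means: for all $e\in\mathcal{C}(\mathcal{F})_k$, $(a_1,b_1)\in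 e(G_1)$ implies $(a_2,b_2)\in e(G_2)$. Atomic expressions $1',0',R,R^{-1}$; $\mathrm{aexp}(\mathcal{F})$ those in $\mathcal{C}(\mathcal{F})$; $\mathrm{atp}^{\mathcal{F}}(G,a,b)=\{e\in\mathrm{aexp}(\mathcal{F}):(a,b)\in e(G)\}$. Simulation. For $Z,W\subseteq V_1^2\times V_2^2$, $i>0$, $P_j=\mathrm{paths}^{\mathcal{F}}_{i-1}(G_j)$, a tuple $(a_1,b_1,a_2,b_2)$ has, w.r.t. $(Z,W)$: Atoms Forth/Back: $\mathrm{atp}^{\mathcal{F}}(G_1,a_1,b_1)\subseteq$ / $\supseteq\mathrm{atp}^{\mathcal{F}}(G_2,a_2,b_2)$. Composition Forth: every $c_1$ with $(a_1,c_1),(c_1,b_1)\in P_1$ has $c_2$ with $(a_1,c_1,a_2,c_2),(c_1,b_1,c_2,b_2)\in Z$. Composition Back: every $c_2$ with $(a_2,c_2),(c_2,b_2)\in P_2$ has $c_1$ with $(a_1,c_1,a_2,c_2),(c_1,b_1,c_2,b_2)\in W$. Projection Forth: $a_1\ne b_1$, or $a_1=b_1$, $a_2=b_2$ and every $c_1$ with $(a_1,c_1)\in P_1$ has $c_2$ with $(a_1,c_1,a_2,c_2)\in Z$, and moreover if $a_1=b_1$ every $c_1$ with $(c_1,a_1)\in P_1$ has $c_2$ with $(c_1,a_1,c_2,a_2)\in Z$. Projection Back: $a_2\ne b_2$, or $a_2=b_2$, $a_1=b_1$ and every $c_2$ with $(a_2,c_2)\in P_2$ has $c_1$ with $(a_1,c_1,a_2,c_2)\in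 W$, and moreover if $a_2=b_2$ every $c_2$ with $(c_2,a_2)\in P_2$ has $c_1$ with $(c_1,a_1,c_2,a_2)\in W$. Coprojection Forth: $a_1\neq b_1$, or $a_1=b_1$, $a_2=b_2$ and every $c_2$ with $(a_2,c_2)\in P_2$ has $c_1$ with $(a_1,c_1,a_2,c_2)\in W$, and moreover if $a_1=b_1$ every $c_2$ with $(c_2,a_2)\in P_2$ has $c_1$ with $(c_1,a_1,c_2,a_2)\in W$. Coprojection Back: $a_2\ne b_2$, or $a_2=b_2$, $a_1=b_1$ and every $c_1$ with $(a_1,c_1)\in P_1$ has $c_2$ with $(a_1,c_1,a_2,c_2)\in Z$, and moreover if $a_2=b_2$ every $c_1$ with $(c_1,a_1)\in P_1$ has $c_2$ with $(c_1,a_1,c_2,a_2)\in Z$. Left Residual Forth: every $c_2$ with $(b_2,c_2)\in P_2$ has $c_1$ with $(b_1,c_1,b_2,c_2)\in W$ and ($(a_1,c_1)\notin P_1$ or $(a_1,c_1,a_2,c_2)\in Z$). Left Residual Back: every $c_1$ with $(b_1,c_1)\in P_1$ has $c_2$ with $(b_1,c_1,b_2,c_2)\in Z$ and ($(a_2,c_2)\notin P_2$ or $(a_1,c_1,a_2,c_2)\in W$). Right Residual Forth: every $c_2$ with $(c_2,a_2)\in P_2$ has $c_1$ with $(c_1,a_1,c_2,a_2)\in W$ and ($(c_1,b_1)\notin P_1$ or $(c_1,b_1,c_2,b_2)\in Z$). Right Residual Back: every $c_1$ with $(c_1,a_1)\in P_1$ has $c_2$ with $(c_1,a_1,c_2,a_2)\in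 Z$ and ($(c_2,b_2)\notin P_2$ or $(c_1,b_1,c_2,b_2)\in W$). An $(\mathcal{F},k)$-simulation from $G_1$ to $G_2$ is a pair of decreasing sequences $Z_0\supseteq\dots\supseteq Z_k$, $W_0\supseteq\dots\supseteq W_k$ of subsets of $V_1^2\times V_2^2$ such that: elements of $Z_0$ have Atoms Forth; elements of $W_0$ have Atoms Back; for $1\le i\le k$, elements of $Z_i$ have (at degree $i$ w.r.t. $(Z_{i-1},W_{i-1})$) Composition Forth, Projection Forth if $\pi\in\mathcal{F}$, Coprojection Forth if $\bar\pi\in\mathcal{F}$, Left (Right) Residual Forth if $/$ ($\backslash$) $\in\mathcal{F}$; and elements of $W_i$ have the corresponding Back properties. $(G_1,a_1,b_1)$ is $(\mathcal{F},k)$-similar to $(G_2,a_2,b_2)$ if some such simulation has $(a_1,b_1,a_2,b_2)\in Z_k$.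
   Formalization: As stated this fails when F contains the converse and exactly one of the residuals /, \ (e.g. F={⁻¹,/}, k=1, expression (R/R)⁻¹). In the formal version, similarity then requires both the Left and Right Residual conditions; for all other F it is unchanged. *)

(* Defs.v *)
From mathcomp Require Import all_boot.

Set Implicit Arguments.
Unset Strict Implicit.
Unset Printing Implicit Defensive.

(* The admissible nonbasic features: 0', 1, converse, both projections, both
   coprojections, left residual e1 / e2, right residual e1 \ e2.  Complement and
   set difference are absent, so F : feature -> bool ranges exactly over the
   subsets of { 0', 1, ^-1, pi, copi, /, \ }. *)
Inductive feature : Type :=
  FDi | FAll | FConv | FProj | FCoproj | FLres | FRres.

Record structure (L : Type) : Type := Structure {
  node : Type;
  edge : L -> node -> node -> Prop
}.

Record marked (L : Type) : Type := Marked {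
  mstr :> structure L;
  msrc : node mstr;
  mtgt : node mstr
}.

Inductive expr (L : Type) : Type :=
| EName of L
| EZero
| EAll
| EDi
| EId
| ECup of expr L & expr L
| ECap of expr L & expr L
| EComp of expr L & expr L
| ELres of expr L & expr L
| ERres of expr L & expr L
| EConv of expr L
| EProj1 of expr L
| EProj2 of expr L
| ECoproj1 of expr L
| ECoproj2 of expr L.

Arguments EName {L}.
Arguments EZero {L}.
Arguments EAll {L}.
Arguments EDi {L}.
Arguments EId {L}.

Fixpoint sem (L : Type) (G : structure L) (e : expr L) (s t : node G) : Prop :=
  match e with
  | EName R => edge R s t
  | EZero => False
  | EAll => True
  | EDi => s <> t
  | EId => s = t
  | ECup e1 e2 => sem e1 s t \/ sem e2 s t
  | ECap e1 e2 => sem e1 s t /\ sem e2 s t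
  | EComp e1 e2 => exists v, sem e1 s v /\ sem e2 v t
  | ELres e1 e2 => forall v, sem e2 t v -> sem e1 s v
  | ERres e1 e2 => forall v, sem e1 v s -> sem e2 v t
  | EConv e1 => sem e1 t s
  | EProj1 e1 => s = t /\ exists v, sem e1 s v
  | EProj2 e1 => s = t /\ exists v, sem e1 v s
  | ECoproj1 e1 => s = t /\ ~ exists v, sem e1 s v
  | ECoproj2 e1 => s = t /\ ~ exists v, sem e1 v s
  end.

Fixpoint degree (L : Type) (e : expr L) : nat :=
  match e with
  | EName _ | EZero | EAll | EDi | EId => 0
  | ECup e1 e2 | ECap e1 e2 => maxn (degree e1) (degree e2)
  | EComp e1 e2 | ELres e1 e2 | ERres e1 e2 => (maxn (degree e1) (degree e2)).+1
  | EConv e1 => degree e1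
  | EProj1 e1 | EProj2 e1 | ECoproj1 e1 | ECoproj2 e1 => (degree e1).+1
  end.

(* in_calc F e: e belongs to C(F). *)
Fixpoint in_calc (F : feature -> bool) (L : Type) (e : expr L) : bool :=
  match e with
  | EName _ | EZero | EId => true
  | EAll => F FAll
  | EDi => F FDi
  | ECup e1 e2 | ECap e1 e2 | EComp e1 e2 => in_calc F e1 && in_calc F e2
  | ELres e1 e2 => [&& F FLres, in_calc F e1 & in_calc F e2]
  | ERres e1 e2 => [&& F FRres, in_calc F e1 & in_calc F e2]
  | EConv e1 => F FConv && in_calc F e1
  | EProj1 e1 | EProj2 e1 => F FProj && in_calc F e1
  | ECoproj1 e1 | ECoproj2 e1 => F FCoproj && in_calc F e1
  end.

Definition sqsubseteq (F : feature -> bool) (k : nat) (L : Type)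
    (G1 G2 : marked L) : Prop :=
  forall e : expr L, in_calc F e -> degree e <= k ->
    sem e (msrc G1) (mtgt G1) -> sem e (msrc G2) (mtgt G2).

Fixpoint walk (V : Type) (E : V -> V -> Prop) (n : nat) (s t : V) : Prop :=
  if n is m.+1 then exists v, E s v /\ walk E m v t else s = t.

Definition any_edge (L : Type) (G : structure L) (s t : node G) : Prop :=
  exists R : L, edge R s t.

Definition paths (L : Type) (k : nat) (G : structure L) (s t : node G) : Prop :=
  exists n, n <= 2 ^ k /\ walk (@any_edge L G) n s t.

Definition upaths (L : Type) (k : nat) (G : structure L) (s t : node G) : Prop :=
  exists n, n <= 2 ^ k /\
    walk (fun u v : node G => any_edge u v \/ any_edge v u) n s t.

(* all_at F k: the full relation 1 is present at degree k. *)
Definition all_at (F : feature -> bool) (k : nat) : bool :=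
  [|| F FAll, F FDi | (0 < k) && (F FLres || F FRres)].

Definition fpaths (F : feature -> bool) (L : Type) (k : nat) (G : structure L)
    (s t : node G) : Prop :=
  if all_at F k then True
  else if F FConv then upaths k s t else paths k s t.

Definition atomic (L : Type) (e : expr L) : bool :=
  match e with
  | EId | EDi | EName _ | EConv (EName _) => true
  | _ => false
  end.

Definition atp (F : feature -> bool) (L : Type) (G : structure L) (a b : node G)
    (e : expr L) : Prop :=
  [/\ atomic e, in_calc F e & sem e a b].

(* In the presence of converse each residual is definable from the other one at
   the same degree, e1 \ e2 = (e2^-1 / e1^-1)^-1, so C(F) then has both as soon
   as F contains one of them.  The residual clauses of a simulation have to be
   governed by this derived presence.  For F = {^-1, /}, say, the clause for /
   alone does not preserve (R / R)^-1, which is a right residual. *)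
Definition has_lres (F : feature -> bool) : bool :=
  F FLres || (F FConv && F FRres).
Definition has_rres (F : feature -> bool) : bool :=
  F FRres || (F FConv && F FLres).

Section Properties.

Variables (L : Type) (F : feature -> bool) (G1 G2 : structure L).

Definition quad : Type := node G1 -> node G1 -> node G2 -> node G2 -> Prop.

Variables (P1 : node G1 -> node G1 -> Prop) (P2 : node G2 -> node G2 -> Prop).
Variables (Z W : quad).
Variables (a1 b1 : node G1) (a2 b2 : node G2).

Definition atoms_forth : Prop := forall e, atp F a1 b1 e -> atp F a2 b2 e.
Definition atoms_back : Prop := forall e, atp F a2 b2 e -> atp F a1 b1 e.

Definition comp_forth : Prop :=
  forall c1, P1 a1 c1 -> P1 c1 b1 -> exists c2, Z a1 c1 a2 c2 /\ Z c1 b1 c2 b2.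
Definition comp_back : Prop :=
  forall c2, P2 a2 c2 -> P2 c2 b2 -> exists c1, W a1 c1 a2 c2 /\ W c1 b1 c2 b2.

Definition proj_forth : Prop :=
  (a1 <> b1 \/
   [/\ a1 = b1, a2 = b2 & forall c1, P1 a1 c1 -> exists c2, Z a1 c1 a2 c2]) /\
  (a1 = b1 -> forall c1, P1 c1 a1 -> exists c2, Z c1 a1 c2 a2).
Definition proj_back : Prop :=
  (a2 <> b2 \/
   [/\ a2 = b2, a1 = b1 & forall c2, P2 a2 c2 -> exists c1, W a1 c1 a2 c2]) /\
  (a2 = b2 -> forall c2, P2 c2 a2 -> exists c1, W c1 a1 c2 a2).

Definition coproj_forth : Prop :=
  (a1 <> b1 \/
   [/\ a1 = b1, a2 = b2 & forall c2, P2 a2 c2 -> exists c1, W a1 c1 a2 c2]) /\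
  (a1 = b1 -> forall c2, P2 c2 a2 -> exists c1, W c1 a1 c2 a2).
Definition coproj_back : Prop :=
  (a2 <> b2 \/
   [/\ a2 = b2, a1 = b1 & forall c1, P1 a1 c1 -> exists c2, Z a1 c1 a2 c2]) /\
  (a2 = b2 -> forall c1, P1 c1 a1 -> exists c2, Z c1 a1 c2 a2).

Definition lres_forth : Prop :=
  forall c2, P2 b2 c2 ->
    exists c1, W b1 c1 b2 c2 /\ (~ P1 a1 c1 \/ Z a1 c1 a2 c2).
Definition lres_back : Prop :=
  forall c1, P1 b1 c1 ->
    exists c2, Z b1 c1 b2 c2 /\ (~ P2 a2 c2 \/ W a1 c1 a2 c2).

Definition rres_forth : Prop :=
  forall c2, P2 c2 a2 ->
    exists c1, W c1 a1 c2 a2 /\ (~ P1 c1 b1 \/ Z c1 b1 c2 b2).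
Definition rres_back : Prop :=
  forall c1, P1 c1 a1 ->
    exists c2, Z c1 a1 c2 a2 /\ (~ P2 c2 b2 \/ W c1 b1 c2 b2).

Definition forth : Prop :=
  [/\ comp_forth, F FProj -> proj_forth, F FCoproj -> coproj_forth,
      has_lres F -> lres_forth & has_rres F -> rres_forth].
Definition back : Prop :=
  [/\ comp_back, F FProj -> proj_back, F FCoproj -> coproj_back,
      has_lres F -> lres_back & has_rres F -> rres_back].

End Properties.

(* Only the members of Z and W with index at most k are constrained, so they
   stand for the finite sequences Z_0, ..., Z_k and W_0, ..., W_k. *)
Record simulation (L : Type) (F : feature -> bool) (k : nat)
    (G1 G2 : structure L) (Z W : nat -> quad G1 G2) : Prop := Simulation {
  sim_Z_decr : forall i, i < k ->
    forall a1 b1 a2 b2, Z i.+1 a1 b1 a2 b2 -> Z i a1 b1 a2 b2;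
  sim_W_decr : forall i, i < k ->
    forall a1 b1 a2 b2, W i.+1 a1 b1 a2 b2 -> W i a1 b1 a2 b2;
  sim_Z_atoms : forall a1 b1 a2 b2, Z 0 a1 b1 a2 b2 -> atoms_forth F a1 b1 a2 b2;
  sim_W_atoms : forall a1 b1 a2 b2, W 0 a1 b1 a2 b2 -> atoms_back F a1 b1 a2 b2;
  sim_Z_forth : forall i, i < k -> forall a1 b1 a2 b2, Z i.+1 a1 b1 a2 b2 ->
    forth F (@fpaths F L i G1) (@fpaths F L i G2) (Z i) (W i) a1 b1 a2 b2;
  sim_W_back : forall i, i < k -> forall a1 b1 a2 b2, W i.+1 a1 b1 a2 b2 ->
    back F (@fpaths F L i G1) (@fpaths F L i G2) (Z i) (W i) a1 b1 a2 b2
}.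

Definition similar (F : feature -> bool) (k : nat) (L : Type)
    (G1 G2 : marked L) : Prop :=
  exists Z W : nat -> quad G1 G2,
    simulation F k Z W /\ Z k (msrc G1) (mtgt G1) (msrc G2) (mtgt G2).

(* Main.v *)
(* If a simulation is given, Z_i preserves the expressions of degree at most i
   forwards and W_i backwards, by induction on expressions: the witnesses met
   along the way lie in paths_(i-1), which contains every expression of degree
   at most i - 1.  Conversely let Z_i and W_i be preservation of C(F)_i itself,
   in the two directions.  Since there are finitely many relation names, C(F)_i
   is finite up to equivalence, so for every pair in paths_i the intersection of
   the expressions true at it, and for every pair the union of those false at
   it, are expressions of degree i.  Violating a clause of the definition at
   degree i + 1 would be detected by the corresponding operation applied to
   these.  Paths matter because the intersection of no expressions at all, the
   full relation, may be missing from C(F)_i. *)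
Require Import Defs.
From HB Require Import structures.
From mathcomp Require Import all_boot.
From mathcomp Require Import boolp.

Set Implicit Arguments.
Unset Strict Implicit.
Unset Printing Implicit Defensive.

(** * Path relations and their description by expressions of bounded degree *)

Section Paths.

Variable F : feature -> bool.
Variable L : Type.

(** Symmetrised exactly when converse is available, so that directed and undirected paths are both
    walks along one relation. *)
Definition fedge (G : structure L) (u v : node G) : Prop :=
  if F FConv then any_edge u v \/ any_edge v u else any_edge u v.

Lemma fpathsE k (G : structure L) (s t : node G) :
  fpaths F k s t <->
  all_at F k \/ exists n, n <= 2 ^ k /\ walk (@fedge G) n s t.
Proof.
rewrite /fpaths /fedge; case: (all_at F k); first by split=> // _; left.
by case: (F FConv); split=> [|[]] //; right.
Qed.

Lemma walk_cat (V : Type) (E : V -> V -> Prop) m n s u t :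
  walk E m s u -> walk E n u t -> walk E (m + n) s t.
Proof.
elim: m s => [|m IHm] s /=; first by move->.
by case=> v [Esv Wvu] Wut; exists v; split=> //; apply: IHm.
Qed.

Lemma walk_split (V : Type) (E : V -> V -> Prop) m n s t :
  walk E (m + n) s t -> exists u, walk E m s u /\ walk E n u t.
Proof.
elim: m s => [|m IHm] s /=; first by exists s.
by case=> v [Esv /IHm[u [Wvu Wut]]]; exists u; split=> //; exists v.
Qed.

Lemma walk_sym (V : Type) (E : V -> V -> Prop) n s t :
  (forall u v, E u v -> E v u) -> walk E n s t -> walk E n t s.
Proof.
move=> symE; elim: n s t => [|n IHn] s t /=; first by move->.
case=> v [Esv /IHn Wtv]; suff: walk E (n + 1) t s by rewrite addn1.
by apply: (walk_cat Wtv); exists s; split=> //; apply: symE.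
Qed.

Lemma all_atW k l : k <= l -> all_at F k -> all_at F l.
Proof.
rewrite /all_at => lekl /or3P[->|->|/andP[k0 FR]]; rewrite ?orbT //.
by rewrite FR (leq_trans k0 lekl) !orbT.
Qed.

Lemma fpaths_refl k (G : structure L) (s : node G) : fpaths F k s s.
Proof. by apply/fpathsE; right; exists 0. Qed.

Lemma fpaths_sym k (G : structure L) (s t : node G) :
  F FConv -> fpaths F k s t -> fpaths F k t s.
Proof.
move=> FC /fpathsE[allk|[n [len Wst]]]; apply/fpathsE; first by left.
right; exists n; split=> //; apply: walk_sym Wst => u v.
by rewrite /fedge FC => -[]; [right | left].
Qed.

Lemma fpaths_comp k (G : structure L) (s u t : node G) :
  fpaths F k s u -> fpaths F k u t -> fpaths F k.+1 s t.
Proof.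
move=> /fpathsE[allk|[m [lem Wsu]]] /fpathsE[allk'|[n [len Wut]]];
  apply/fpathsE; try by left; apply: (@all_atW k).
right; exists (m + n); split; last exact: walk_cat Wut.
by rewrite expnS mul2n -addnn leq_add.
Qed.

Definition calc k (e : expr L) : bool := in_calc F e && (degree e <= k).

Lemma calcP k e : reflect (in_calc F e /\ degree e <= k) (calc k e).
Proof. exact: andP. Qed.

(** Composition raises the degree by one and at most doubles the length of a walk, in step with the
    bound [2 ^ k]. A residual has positive degree and presupposes a residual in [F], so the full
    relation is present at its degree. *)
Lemma sem_fpaths k (e : expr L) (G : structure L) (s t : node G) :
  calc k e -> sem e s t -> fpaths F k s t.
Proof.
have fE l (a b : node G) : all_at F l -> fpaths F l a b.
  by move=> al; apply/fpathsE; left.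
move/calcP=> [Fe dek].
elim: e k s t Fe dek => /=.
- move=> R k s t _ _ Rst; apply/fpathsE; right; exists 1.
  split; first by rewrite expn_gt0.
  by exists t; split=> //; rewrite /fedge; case: (F FConv); [left|]; exists R.
- by [].
- by move=> k s t FA _ _; apply: fE; rewrite /all_at FA.
- by move=> k s t FD _ _; apply: fE; rewrite /all_at FD orbT.
- by move=> k s t _ _ ->; apply: fpaths_refl.
- move=> e1 IH1 e2 IH2 k s t /andP[F1 F2].
  by rewrite geq_max => /andP[d1 d2] [/IH1|/IH2]; apply.
- move=> e1 IH1 e2 IH2 k s t /andP[F1 F2].
  by rewrite geq_max => /andP[d1 d2] [/IH1 + _]; apply.
- move=> e1 IH1 e2 IH2 [|k] s t /andP[F1 F2] //.
  rewrite ltnS geq_max => /andP[d1 d2] [v [s1 s2]].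
  by apply: (@fpaths_comp _ _ _ v); [apply: IH1 | apply: IH2].
- move=> e1 _ e2 _ [|k] s t /and3P[FR F1 F2] // _ _.
  by apply: fE; rewrite /all_at FR !orbT.
- move=> e1 _ e2 _ [|k] s t /and3P[FR F1 F2] // _ _.
  by apply: fE; rewrite /all_at FR !orbT.
- move=> e IH k s t /andP[FC Fe] de ets.
  by apply: fpaths_sym => //; apply: IH.
all: by move=> e _ k s t _ _ [-> _]; apply: fpaths_refl.
Qed.

(** Ensures that the expressions of degree at most [k] true at a path pair have a nonempty
    intersection. A walk is halved [k] times, and the pieces are single edges or identities. *)
Lemma fpaths_sem k (G : structure L) (s t : node G) :
  fpaths F k s t -> exists2 e : expr L, calc k e & sem e s t.
Proof.
move/fpathsE=> [/or3P[FA|FD|/andP[k0 /orP[FR|FR]]]|].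
- by exists EAll; rewrite // /calc /= FA.
(* Without [1], the full relation is the union of [0'] and [1'], or a residual of [0] by [0], which
   holds vacuously. *)
- exists (ECup EDi EId); first by rewrite /calc /= FD.
  by rewrite /=; case: (EM (s = t)); [right | left].
- by exists (ELres EZero EZero); rewrite /calc /= ?FR.
- by exists (ERres EZero EZero); rewrite /calc /= ?FR.
elim: k s t => [|k IHk] s t [n [len Wst]].
  case: n => [|[|//]] in len Wst *; first by exists EId.
  case: Wst => v /= [+ <-]; rewrite /fedge.
  have nameE R : edge R s v -> exists2 e : expr L, calc 0 e & sem e s v.
    by exists (EName R).
  case FC: (F FConv); last by case=> R /nameE.
  case=> [[R /nameE //]|[R Rvs]].
  by exists (EConv (EName R)); rewrite // /calc /= FC.
(* The walk is cut after [2 ^ k] steps, or at its end if it is shorter; truncated subtraction then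
   makes the second part empty. *)
have [m1 [m2 [l1 l2 def_n]]] :
    exists m1 m2, [/\ m1 <= 2 ^ k, m2 <= 2 ^ k & n = m1 + m2].
  exists (minn n (2 ^ k)), (n - 2 ^ k); split; first exact: geq_minr.
    by rewrite leq_subLR addnn -mul2n -expnS.
  by rewrite minnE subnK ?leq_subr.
rewrite def_n in Wst; have [u [Wsu Wut]] := walk_split Wst.
have [e1 /calcP[F1 d1] s1] := IHk s u (ex_intro _ m1 (conj l1 Wsu)).
have [e2 /calcP[F2 d2] s2] := IHk u t (ex_intro _ m2 (conj l2 Wut)).
exists (EComp e1 e2); last by exists u.
by rewrite /calc /= F1 F2 ltnS geq_max d1 d2.
Qed.

End Paths.

(** * Simulations preserve expressions *)

Section Soundness.

Variables (F : feature -> bool) (L : Type).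

Definition qswap (G1 G2 : structure L) (Z : quad G1 G2) : quad G2 G1 :=
  fun a2 b2 a1 b1 => Z a1 b1 a2 b2.

(** Each back clause unfolds to the forth clause with the structures, and [Z] and [W], exchanged.
    Facts about [W] thus follow from facts about [Z]. *)
Lemma simulation_swap k (G1 G2 : structure L) (Z W : nat -> quad G1 G2) :
  simulation F k Z W ->
  simulation F k (fun i => qswap (W i)) (fun i => qswap (Z i)).
Proof.
case=> Zd Wd Za Wa Zf Wb; split=> /=.
- by move=> i ik a1 b1 a2 b2; apply: Wd.
- by move=> i ik a1 b1 a2 b2; apply: Zd.
- by move=> a1 b1 a2 b2; apply: Wa.
- by move=> a1 b1 a2 b2; apply: Za.
- by move=> i ik a1 b1 a2 b2; apply: Wb.
- by move=> i ik a1 b1 a2 b2; apply: Zf.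
Qed.

Lemma sim_Z_atoms_le k (G1 G2 : structure L) (Z W : nat -> quad G1 G2) :
  simulation F k Z W -> forall i, i <= k -> forall a1 b1 a2 b2,
  Z i a1 b1 a2 b2 -> forall e : expr L, atomic e -> in_calc F e ->
  sem e a1 b1 -> sem e a2 b2.
Proof.
move=> sZW; elim=> [|i IHi] lik a1 b1 a2 b2; last first.
  by move/(sim_Z_decr sZW lik)/IHi; apply; apply: ltnW.
move=> /(sim_Z_atoms sZW) at0 e ae Fe s1.
by have [] : atp F a2 b2 e by apply: at0; split.
Qed.

(** A subrelation of the identity is its own converse, so the forward half yields the converse half.
    This serves all projections and coprojections. *)
Lemma coreflexive_forth (e : expr L) (P : Prop) (G1 G2 : structure L)
    (a1 b1 : node G1) (a2 b2 : node G2) :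
  (forall (G : structure L) (a b : node G), sem e a b -> a = b) ->
  (sem e a1 b1 -> sem e a2 b2) ->
  (sem e a1 b1 -> sem e a2 b2) /\ (P -> sem e b1 a1 -> sem e b2 a2).
Proof.
move=> diag A; split=> // _ s1; have eab := diag _ _ _ s1; subst b1.
by have s2 := A s1; have eab := diag _ _ _ s2; subst b2.
Qed.

(* Simulations only speak of converses of relation names.  Carrying [e^-1] along
   with [e] pushes converses inwards: [e1 / e2] read backwards is a right
   residual, [e1 \ e2] a left one. *)
Lemma simulation_sem k (e : expr L) : in_calc F e ->
  forall (G1 G2 : structure L) (Z W : nat -> quad G1 G2), simulation F k Z W ->
  forall i, i <= k -> degree e <= i -> forall a1 b1 a2 b2, Z i a1 b1 a2 b2 ->
  (sem e a1 b1 -> sem e a2 b2) /\ (F FConv -> sem e b1 a1 -> sem e b2 a2).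
Proof.
elim: e => /=.
- move=> R _ G1 G2 Z W sZW i ik _ a1 b1 a2 b2 /(sim_Z_atoms_le sZW ik) at_.
  split=> [|FC]; first exact: at_ (EName R) _ _.
  by apply: (at_ (EConv (EName R))); rewrite //= FC.
- by [].
- by [].
- move=> FD G1 G2 Z W sZW i ik _ a1 b1 a2 b2 /(sim_Z_atoms_le sZW ik) at_.
  split=> [|_ nba eba]; first exact: at_ EDi _ _.
  by apply: (at_ EDi) (esym eba) => // eab; apply: nba.
- move=> _ G1 G2 Z W sZW i ik _ a1 b1 a2 b2 /(sim_Z_atoms_le sZW ik) at_.
  by split=> [|_ eba]; [exact: at_ EId _ _ | rewrite (at_ EId)].
- move=> e1 IH1 e2 IH2 /andP[F1 F2] G1 G2 Z W sZW i ik.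
  rewrite geq_max => /andP[d1 d2] a1 b1 a2 b2 Zi.
  have [A1 B1] := IH1 F1 _ _ _ _ sZW i ik d1 _ _ _ _ Zi.
  have [A2 B2] := IH2 F2 _ _ _ _ sZW i ik d2 _ _ _ _ Zi.
  by split=> [|FC] [?|?]; [left|right|left|right]; auto.
- move=> e1 IH1 e2 IH2 /andP[F1 F2] G1 G2 Z W sZW i ik.
  rewrite geq_max => /andP[d1 d2] a1 b1 a2 b2 Zi.
  have [A1 B1] := IH1 F1 _ _ _ _ sZW i ik d1 _ _ _ _ Zi.
  have [A2 B2] := IH2 F2 _ _ _ _ sZW i ik d2 _ _ _ _ Zi.
  by split=> [|FC] [? ?]; split; auto.
- move=> e1 IH1 e2 IH2 /andP[F1 F2] G1 G2 Z W sZW [|i] ik //.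
  rewrite ltnS geq_max => /andP[d1 d2] a1 b1 a2 b2.
  have c1 : calc F i e1 by apply/calcP.
  have c2 : calc F i e2 by apply/calcP.
  move=> /(sim_Z_forth sZW ik)[fc _ _ _ _]; split=> [|FC] [v [s1 s2]].
    have [||w [Z1 Z2]] := fc v; [exact: sem_fpaths s1|exact: sem_fpaths s2|].
    exists w; split.
      by have [A _] := IH1 F1 _ _ _ _ sZW i (ltnW ik) d1 _ _ _ _ Z1; apply: A.
    by have [A _] := IH2 F2 _ _ _ _ sZW i (ltnW ik) d2 _ _ _ _ Z2; apply: A.
  (* Now [e1] leads from [b1] to [v] and [e2] from [v] to [a1]. Paths are symmetric in the presence
     of converse, so the clause applies with the factors in reverse order. *)
  have [||w [Z2 Z1]] := fc v.
  + by apply: fpaths_sym => //; exact: sem_fpaths s2.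
  + by apply: fpaths_sym => //; exact: sem_fpaths s1.
  exists w; split.
    by have [_ A] := IH1 F1 _ _ _ _ sZW i (ltnW ik) d1 _ _ _ _ Z1; apply: A.
  by have [_ A] := IH2 F2 _ _ _ _ sZW i (ltnW ik) d2 _ _ _ _ Z2; apply: A.
- move=> e1 IH1 e2 IH2 /and3P[FR F1 F2] G1 G2 Z W sZW [|i] ik //.
  rewrite ltnS geq_max => /andP[d1 d2] a1 b1 a2 b2.
  have c1 : calc F i e1 by apply/calcP.
  have c2 : calc F i e2 by apply/calcP.
  have sWZ := simulation_swap sZW.
  move=> /(sim_Z_forth sZW ik)[_ _ _ fl fr]; split=> [e12 w s2|FC e12 w s2].
    (* [W] pulls [e2] back to the pair [b1], [v], where the residual yields [e1] at [a1], [v]. That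
       pair is therefore a path, which leaves the [Z] alternative to push [e1] forward. *)
    have [||v [W2 Z1]] := fl _ w; first by rewrite /has_lres FR.
      exact: sem_fpaths s2.
    have [A _] := IH2 F2 _ _ _ _ sWZ i (ltnW ik) d2 _ _ _ _ W2.
    have s1 := e12 _ (A s2).
    case: Z1 => [[]|Z1]; first exact: sem_fpaths s1.
    by have [B _] := IH1 F1 _ _ _ _ sZW i (ltnW ik) d1 _ _ _ _ Z1; apply: B.
  have [||v [W2 Z1]] := fr _ w; first by rewrite /has_rres FC FR orbT.
    by apply: fpaths_sym => //; exact: sem_fpaths s2.
  have [_ A] := IH2 F2 _ _ _ _ sWZ i (ltnW ik) d2 _ _ _ _ W2.
  have s1 := e12 _ (A FC s2).
  case: Z1 => [[]|Z1]; first by apply: fpaths_sym => //; exact: sem_fpaths s1.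
  by have [_ B] := IH1 F1 _ _ _ _ sZW i (ltnW ik) d1 _ _ _ _ Z1; apply: B.
- move=> e1 IH1 e2 IH2 /and3P[FR F1 F2] G1 G2 Z W sZW [|i] ik //.
  rewrite ltnS geq_max => /andP[d1 d2] a1 b1 a2 b2.
  have c1 : calc F i e1 by apply/calcP.
  have c2 : calc F i e2 by apply/calcP.
  have sWZ := simulation_swap sZW.
  move=> /(sim_Z_forth sZW ik)[_ _ _ fl fr]; split=> [e12 w s1|FC e12 w s1].
    have [||v [W1 Z2]] := fr _ w; first by rewrite /has_rres FR.
      exact: sem_fpaths s1.
    have [A _] := IH1 F1 _ _ _ _ sWZ i (ltnW ik) d1 _ _ _ _ W1.
    have s2 := e12 _ (A s1).
    case: Z2 => [[]|Z2]; first exact: sem_fpaths s2.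
    by have [B _] := IH2 F2 _ _ _ _ sZW i (ltnW ik) d2 _ _ _ _ Z2; apply: B.
  have [||v [W1 Z2]] := fl _ w; first by rewrite /has_lres FC FR orbT.
    by apply: fpaths_sym => //; exact: sem_fpaths s1.
  have [_ A] := IH1 F1 _ _ _ _ sWZ i (ltnW ik) d1 _ _ _ _ W1.
  have s2 := e12 _ (A FC s1).
  case: Z2 => [[]|Z2]; first by apply: fpaths_sym => //; exact: sem_fpaths s2.
  by have [_ B] := IH2 F2 _ _ _ _ sZW i (ltnW ik) d2 _ _ _ _ Z2; apply: B.
- move=> e IH /andP[FC Fe] G1 G2 Z W sZW i ik de a1 b1 a2 b2 Zi.
  by have [A B] := IH Fe _ _ _ _ sZW i ik de _ _ _ _ Zi; split=> //; apply: B.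
- move=> e IH /andP[FP Fe] G1 G2 Z W sZW [|i] ik //.
  rewrite ltnS => de a1 b1 a2 b2 /(sim_Z_forth sZW ik)[_ /(_ FP) fp _ _ _].
  apply: (@coreflexive_forth (EProj1 e)) => [? ? ? []|] //=.
  move=> [eab [v s1]]; case: fp => -[//|[_ <- f]] _; split=> //.
  have [|w Z1] := f v; first by apply: sem_fpaths s1; apply/calcP.
  exists w.
  by have [A _] := IH Fe _ _ _ _ sZW i (ltnW ik) de _ _ _ _ Z1; apply: A.
- move=> e IH /andP[FP Fe] G1 G2 Z W sZW [|i] ik //.
  rewrite ltnS => de a1 b1 a2 b2 /(sim_Z_forth sZW ik)[_ /(_ FP) fp _ _ _].
  apply: (@coreflexive_forth (EProj2 e)) => [? ? ? []|] //=.
  move=> [eab [v s1]]; case: fp => -[//|[_ <- _]] f; split=> //.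
  have [|w Z1] := f eab v; first by apply: sem_fpaths s1; apply/calcP.
  exists w.
  by have [A _] := IH Fe _ _ _ _ sZW i (ltnW ik) de _ _ _ _ Z1; apply: A.
- move=> e IH /andP[FP Fe] G1 G2 Z W sZW [|i] ik //.
  rewrite ltnS => de a1 b1 a2 b2 /(sim_Z_forth sZW ik)[_ _ /(_ FP) fp _ _].
  apply: (@coreflexive_forth (ECoproj1 e)) => [? ? ? []|] //=.
  move=> [eab ns1]; case: fp => -[//|[_ <- f]] _; split=> // -[w s2].
  (* A successor in the second structure is pulled back along [W] to one in the first, contradicting
     the coprojection there. *)
  have [|v W1] := f w; first by apply: sem_fpaths s2; apply/calcP.
  have sWZ := simulation_swap sZW; apply: ns1; exists v.
  by have [A _] := IH Fe _ _ _ _ sWZ i (ltnW ik) de _ _ _ _ W1; apply: A.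
- move=> e IH /andP[FP Fe] G1 G2 Z W sZW [|i] ik //.
  rewrite ltnS => de a1 b1 a2 b2 /(sim_Z_forth sZW ik)[_ _ /(_ FP) fp _ _].
  apply: (@coreflexive_forth (ECoproj2 e)) => [? ? ? []|] //=.
  move=> [eab ns1]; case: fp => -[//|[_ <- _]] f; split=> // -[w s2].
  have [|v W1] := f eab w; first by apply: sem_fpaths s2; apply/calcP.
  have sWZ := simulation_swap sZW; apply: ns1; exists v.
  by have [A _] := IH Fe _ _ _ _ sWZ i (ltnW ik) de _ _ _ _ W1; apply: A.
Qed.

End Soundness.

(** * Finiteness of each degree up to equivalence *)

HB.instance Definition _ (L : Type) := gen_eqMixin (expr L).

Section Finiteness.

Variable L : Type.
Implicit Types (e x : expr L) (s : seq (expr L)).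

Definition eqe e1 e2 : Prop :=
  forall (G : structure L) (a b : node G), sem e1 a b <-> sem e2 a b.

(* The empty meet would be the full relation, which C(F) may lack; it is given
   the junk value 0. *)
Definition meet s : expr L := if s is x :: s' then foldr (@ECap L) x s' else EZero.
Definition join s : expr L := foldr (@ECup L) EZero s.

Lemma sem_meet s (G : structure L) (a b : node G) :
  sem (meet s) a b <-> s != [::] /\ forall x, x \in s -> sem x a b.
Proof.
case: s => [|x s] /=; first by split=> // -[].
elim: s => [|y s IHs] /=.
  split=> [sx|[_ sP]]; last exact/sP/mem_head.
  by split=> // z; rewrite inE => /eqP->.
split=> [[sy /IHs[_ sP]]|[_ sP]].
  by split=> // z; rewrite !inE => /or3P[/eqP->|/eqP->|zs] //;
    apply: sP; rewrite inE ?eqxx ?zs ?orbT.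
split; first by apply: sP; rewrite !inE eqxx orbT.
by apply/IHs; split=> // z; rewrite inE => /orP[/eqP->|zs];
  apply: sP; rewrite !inE ?eqxx ?zs ?orbT.
Qed.

Lemma sem_join s (G : structure L) (a b : node G) :
  sem (join s) a b <-> exists2 x, x \in s & sem x a b.
Proof.
elim: s => [|x s IHs] /=; first by split=> // -[].
split=> [[sx|/IHs[y ys sy]]|[y]]; first by exists x; rewrite ?mem_head.
  by exists y; rewrite // inE ys orbT.
by rewrite inE => /orP[/eqP->|ys] sy; [left | right; apply/IHs; exists y].
Qed.

Section Closure.

Variables (F : feature -> bool) (k : nat).

Lemma calc_cap e1 e2 : calc F k (ECap e1 e2) = calc F k e1 && calc F k e2.
Proof. by rewrite /calc /= geq_max andbACA. Qed.

Lemma calc_cup e1 e2 : calc F k (ECup e1 e2) = calc F k e1 && calc F k e2.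
Proof. exact: calc_cap. Qed.

Lemma calc_conv e : calc F k (EConv e) = F FConv && calc F k e.
Proof. by rewrite /calc /= andbA. Qed.

Lemma calc_meet s : {in s, forall x, calc F k x} -> calc F k (meet s).
Proof.
case: s => [|x s] // /allP /= /andP[cx cs].
by elim: s cs => //= y s IHs /andP[cy /IHs]; rewrite calc_cap cy.
Qed.

Lemma calc_join s : {in s, forall x, calc F k x} -> calc F k (join s).
Proof.
move/allP; elim: s => //= y s IHs /andP[cy /IHs].
by rewrite calc_cup cy.
Qed.

End Closure.

(** Encoded by bit masks, so that every [filter p s] is literally a member. *)
Definition subs (T : Type) (s : seq T) : seq (seq T) :=
  [seq mask (tval m) s | m <- enum {: (size s).-tuple bool}].

Lemma filter_subs (T : eqType) (p : pred T) (s : seq T) : filter p s \in subs s.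
Proof.
apply/mapP; exists (map_tuple p (in_tuple s)); first by rewrite mem_enum.
by rewrite filter_mask.
Qed.

Lemma mem_subs (T : eqType) (s r : seq T) : r \in subs s -> {subset r <= s}.
Proof. by case/mapP=> m _ -> x /mem_mask. Qed.

(** Disjunctive normal forms over [s]: a finite list, whatever the depth of nested unions and
    intersections. *)
Definition dnfs s : seq (expr L) := map join (subs (map meet (subs s))).

(* [determined s e] is a semantic form of "[e] is built from members of [s] by
   union and intersection"; unlike the syntactic one, it is evidently stable
   under converse when [s] is. *)
Definition determined s e : Prop :=
  (forall (G : structure L) (a b : node G),
     sem e a b -> exists2 x, x \in s & sem x a b) /\
  (forall (G H : structure L) (a b : node G) (c d : node H),
     (forall x, x \in s -> sem x a b -> sem x c d) -> sem e a b -> sem e c d).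

(** The normal form is the union of all meets contained in [e]. A pair in [e] lies in the meet of
    the members of [s] true at it; that meet is nonempty by the first half of [determined] and
    contained in [e] by the second. *)
Lemma dnfs_determined s e : determined s e -> exists2 d, d \in dnfs s & eqe d e.
Proof.
case=> nz mono.
pose below d := `[< forall (G : structure L) (a b : node G),
                     sem d a b -> sem e a b >].
exists (join (filter below (map meet (subs s)))).
  exact/map_f/filter_subs.
move=> G a b; rewrite sem_join; split=> [[d]|eab].
  by rewrite mem_filter => /andP[/asboolP + _]; apply.
pose r := filter (fun x => `[< sem x a b >]) s.
have rP x : x \in s -> sem x a b -> x \in r.
  by move=> xs sx; rewrite mem_filter xs andbT; apply/asboolP.
exists (meet r); last first.
  apply/sem_meet; split; last first.
    by move=> x; rewrite mem_filter => /andP[/asboolP].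
  by have [x xs sx] := nz _ _ _ eab; apply: contraTneq (rP x xs sx) => ->.
rewrite mem_filter; apply/andP; split; last exact/map_f/filter_subs.
apply/asboolP => H c d /sem_meet[_ all_r]; apply: mono eab => x xs sx.
exact/all_r/rP.
Qed.

Lemma calc_dnfs F k s :
  {in s, forall x, calc F k x} -> {in dnfs s, forall d, calc F k d}.
Proof.
move=> cs _ /mapP[r /mem_subs rs ->]; apply: calc_join => _ /rs /mapP[q + ->].
by move/mem_subs=> qs; apply: calc_meet => x /qs /cs.
Qed.

(** Converse is excluded along with union and intersection because it too leaves the degree
    unchanged. What remains is degree 0 constants and names, or an operation on expressions of
    smaller degree. *)
Definition basic e : bool :=
  match e with ECup _ _ | ECap _ _ | EConv _ => false | _ => true end.

Lemma determined_basic F k s :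
  {in s, forall x, calc F k x} ->
  (forall e, basic e -> calc F k e -> exists2 x, x \in s & eqe x e) ->
  forall e, calc F k e ->
  determined (s ++ [seq EConv x | x <- s & F FConv]) e.
Proof.
move=> cs repr; set s' := _ ++ _.
have det_basic e : basic e -> calc F k e -> determined s' e.
  move=> be ce; have [x xs xe] := repr e be ce.
  have xs' : x \in s' by rewrite mem_cat xs.
  split=> [G a b /xe sx|G H a b c d le_s' /xe sx]; first by exists x.
  exact/xe/le_s'.
(* Up to equivalence [s'] is closed under converse: [x] and [EConv x] are each other's partners. *)
have conv_s' (G : structure L) (a b : node G) x : F FConv -> x \in s' ->
    exists2 y, y \in s' & forall (H : structure L) (c d : node H),
      sem y c d <-> sem x d c.
  move=> FC; rewrite mem_cat => /orP[xs|/mapP[y + ->]].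
    by exists (EConv x); rewrite // mem_cat map_f ?orbT // mem_filter FC.
  by rewrite mem_filter => /andP[_ ys]; exists y; rewrite // mem_cat ys.
elim; try by move=> *; apply: det_basic.
- move=> e1 IH1 e2 IH2; rewrite calc_cup => /andP[/IH1[n1 m1] /IH2[n2 m2]].
  split=> [G a b [/n1|/n2] //|G H a b c d le_s' [s1|s2]].
    by left; apply: m1 s1.
  by right; apply: m2 s2.
- move=> e1 IH1 e2 IH2; rewrite calc_cap => /andP[/IH1[n1 m1] /IH2[n2 m2]].
  split=> [G a b [/n1]//|G H a b c d le_s' [s1 s2]].
  by split; [apply: m1 s1 | apply: m2 s2].
- move=> e IH; rewrite calc_conv => /andP[FC /IH[n m]]; split.
    move=> G a b /n[x xs sx]; have [y ys yx] := conv_s' G a b x FC xs.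
    by exists y => //; apply/yx.
  move=> G H a b c d le_s' /=; apply: m => x xs.
  by have [y ys yx] := conv_s' G a b x FC xs; move=> /yx/(le_s' y ys)/yx.
Qed.

Lemma eqe_comp x y e f : eqe x e -> eqe y f -> eqe (EComp x y) (EComp e f).
Proof.
by move=> xe yf G a b; split=> -[v [sx sy]]; exists v; split;
  [apply/xe|apply/yf|apply/xe|apply/yf].
Qed.

Lemma eqe_lres x y e f : eqe x e -> eqe y f -> eqe (ELres x y) (ELres e f).
Proof. by move=> xe yf G a b; split=> sxy v /yf/sxy/xe. Qed.

Lemma eqe_rres x y e f : eqe x e -> eqe y f -> eqe (ERres x y) (ERres e f).
Proof. by move=> xe yf G a b; split=> sxy v /xe/sxy/yf. Qed.

Lemma eqe_proj1 x e : eqe x e -> eqe (EProj1 x) (EProj1 e).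
Proof. by move=> xe G a b; split=> -[-> [v /xe]]; split=> //; exists v. Qed.

Lemma eqe_proj2 x e : eqe x e -> eqe (EProj2 x) (EProj2 e).
Proof. by move=> xe G a b; split=> -[-> [v /xe]]; split=> //; exists v. Qed.

Lemma eqe_coproj1 x e : eqe x e -> eqe (ECoproj1 x) (ECoproj1 e).
Proof.
by move=> xe G a b; split=> -[-> n]; split=> // -[v /xe] sv; case: n; exists v.
Qed.

Lemma eqe_coproj2 x e : eqe x e -> eqe (ECoproj2 x) (ECoproj2 e).
Proof.
by move=> xe G a b; split=> -[-> n]; split=> // -[v /xe] sv; case: n; exists v.
Qed.

End Finiteness.

(** Candidates are listed for every operation, whatever [F] is; those outside the calculus are
    filtered out in [calc_finite]. *)
Definition basics (L : finType) (s : seq (expr L)) : seq (expr L) :=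
  [:: EZero; EAll; EDi; EId] ++ [seq EName R | R <- enum L] ++
  [seq EComp x y | x <- s, y <- s] ++ [seq ELres x y | x <- s, y <- s] ++
  [seq ERres x y | x <- s, y <- s] ++ [seq EProj1 x | x <- s] ++
  [seq EProj2 x | x <- s] ++ [seq ECoproj1 x | x <- s] ++
  [seq ECoproj2 x | x <- s].

(** Every operation respects [eqe], so arguments may be replaced by representatives. The strict
    bound [degree e < k] lets the same statement cover [k = 0]. *)
Lemma basics_repr (L : finType) F k (s : seq (expr L)) :
  (forall e, in_calc F e -> degree e < k ->
     exists x, [/\ x \in s, in_calc F x, degree x < k & eqe x e]) ->
  forall e, basic e -> calc F k e ->
  exists x, [/\ x \in basics s, calc F k x & eqe x e].
Proof.
move=> repr; case=> //.
- by move=> R _ cR; exists (EName R); split=> //;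
    rewrite !mem_cat map_f ?mem_enum ?orbT.
- by move=> _ ce; exists EZero; split; rewrite // mem_cat !inE eqxx ?orbT.
- by move=> _ ce; exists EAll; split; rewrite // mem_cat !inE eqxx ?orbT.
- by move=> _ ce; exists EDi; split; rewrite // mem_cat !inE eqxx ?orbT.
- by move=> _ ce; exists EId; split; rewrite // mem_cat !inE eqxx ?orbT.
- move=> e1 e2 _ /calcP[/= /andP[F1 F2]]; rewrite gtn_max => /andP[d1 d2].
  have [x [xs Fx dx xe]] := repr _ F1 d1; have [y [ys Fy dy ye]] := repr _ F2 d2.
  exists (EComp x y); split; last exact: eqe_comp.
    by rewrite !mem_cat allpairs_f ?orbT.
  by apply/calcP; rewrite /= Fx Fy gtn_max dx dy.
- move=> e1 e2 _ /calcP[/= /and3P[FR F1 F2]]; rewrite gtn_max => /andP[d1 d2].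
  have [x [xs Fx dx xe]] := repr _ F1 d1; have [y [ys Fy dy ye]] := repr _ F2 d2.
  exists (ELres x y); split; last exact: eqe_lres.
    by rewrite !mem_cat (allpairs_f (@ELres L)) ?orbT.
  by apply/calcP; rewrite /= FR Fx Fy gtn_max dx dy.
- move=> e1 e2 _ /calcP[/= /and3P[FR F1 F2]]; rewrite gtn_max => /andP[d1 d2].
  have [x [xs Fx dx xe]] := repr _ F1 d1; have [y [ys Fy dy ye]] := repr _ F2 d2.
  exists (ERres x y); split; last exact: eqe_rres.
    by rewrite !mem_cat (allpairs_f (@ERres L)) ?orbT.
  by apply/calcP; rewrite /= FR Fx Fy gtn_max dx dy.
- move=> e _ /calcP[/= /andP[FP Fe] /(repr _ Fe)[x [xs Fx dx xe]]].
  exists (EProj1 x); split; last exact: eqe_proj1.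
    by rewrite !mem_cat (map_f (@EProj1 L)) ?orbT.
  by apply/calcP; rewrite /= FP Fx.
- move=> e _ /calcP[/= /andP[FP Fe] /(repr _ Fe)[x [xs Fx dx xe]]].
  exists (EProj2 x); split; last exact: eqe_proj2.
    by rewrite !mem_cat (map_f (@EProj2 L)) ?orbT.
  by apply/calcP; rewrite /= FP Fx.
- move=> e _ /calcP[/= /andP[FP Fe] /(repr _ Fe)[x [xs Fx dx xe]]].
  exists (ECoproj1 x); split; last exact: eqe_coproj1.
    by rewrite !mem_cat (map_f (@ECoproj1 L)) ?orbT.
  by apply/calcP; rewrite /= FP Fx.
- move=> e _ /calcP[/= /andP[FP Fe] /(repr _ Fe)[x [xs Fx dx xe]]].
  exists (ECoproj2 x); split; last exact: eqe_coproj2.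
    by rewrite !mem_cat (map_f (@ECoproj2 L)) ?orbT.
  by apply/calcP; rewrite /= FP Fx.
Qed.

(** Induction on the degree: representatives of smaller degree give finitely many basic expressions,
    and normal forms over these and their converses give the rest. *)
Lemma calc_finite (L : finType) F k : exists s : seq (expr L),
  {in s, forall x, calc F k x} /\
  forall e, calc F k e -> exists2 x, x \in s & eqe x e.
Proof.
have close k' (s : seq (expr L)) :
    (forall e, in_calc F e -> degree e < k' ->
       exists x, [/\ x \in s, in_calc F x, degree x < k' & eqe x e]) ->
    exists s' : seq (expr L), {in s', forall x, calc F k' x} /\
      forall e, calc F k' e -> exists2 x, x \in s' & eqe x e.
  move=> repr; pose b := [seq x <- basics s | calc F k' x].
  have cb : {in b, forall x, calc F k' x} by move=> x; rewrite mem_filter => /andP[].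
  exists (dnfs (b ++ [seq EConv x | x <- b & F FConv])); split.
    apply: calc_dnfs => x; rewrite mem_cat => /orP[/cb //|/mapP[y + ->]].
    by rewrite mem_filter calc_conv => /andP[-> /cb].
  move=> e ce; apply: dnfs_determined; apply: (determined_basic cb) ce.
  move=> {}e be ce; have [x [xb cx xe]] := basics_repr repr be ce.
  by exists x => //; rewrite mem_filter cx.
(* No expression has degree below 0, so the empty list starts the induction. *)
elim: k => [|k [s [cs repr]]]; first exact: (close 0 [::]).
apply: (close k.+1 s) => e Fe de.
have [|x xs xe] := repr e; first exact/calcP.
by exists x; split=> //; have /calcP[] := cs x xs.
Qed.

(** * Preservation of expressions is a simulation *)

Section Completeness.

Variables (L : finType) (F : feature -> bool).

Definition le_sem k (G H : structure L) : quad G H := fun a b c d =>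
  forall e : expr L, calc F k e -> sem e a b -> sem e c d.

(** [x] is the strongest expression true at the pair: the intersection of all representatives true
    there. *)
Lemma upper_expr k (G : structure L) (a b : node G) : fpaths F k a b ->
  exists x : expr L, [/\ calc F k x, sem x a b &
    forall (H : structure L) (c d : node H), sem x c d -> le_sem k a b c d].
Proof.
case/fpaths_sem=> e0 ce0 se0; have [s [cs repr]] := calc_finite L F k.
pose r := filter (fun x => `[< sem x a b >]) s.
have rP x : x \in s -> sem x a b -> x \in r.
  by move=> xs sx; rewrite mem_filter xs andbT; apply/asboolP.
exists (meet r); split.
- by apply: calc_meet => x; rewrite mem_filter => /andP[_ /cs].
- apply/sem_meet; split; last by move=> x; rewrite mem_filter => /andP[/asboolP].
  (* A representative of [e0] is in [r], so the meet is not the junk value. *)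
  by have [x xs /(_ _ _ _)/iffRL/(_ se0) sx] := repr e0 ce0;
    apply: contraTneq (rP x xs sx) => ->.
- move=> H c d /sem_meet[_ all_r] e ce se; have [x xs xe] := repr e ce.
  by apply/xe/all_r/rP => //; apply/xe.
Qed.

(** [y] is the weakest expression false at the pair: the union of all representatives false there.
    The empty union is [0], always in C(F), so pairs off the paths are covered. *)
Lemma lower_expr k (G : structure L) (a b : node G) :
  exists y : expr L, [/\ calc F k y, ~ sem y a b &
    forall (H : structure L) (c d : node H), ~ sem y c d -> le_sem k c d a b].
Proof.
have [s [cs repr]] := calc_finite L F k.
pose r := filter (fun x => `[< ~ sem x a b >]) s.
exists (join r); split.
- by apply: calc_join => x; rewrite mem_filter => /andP[_ /cs].
- by case/sem_join=> x; rewrite mem_filter => /andP[/asboolP].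
- move=> H c d nsy e ce se; have [x xs xe] := repr e ce.
  apply: contrapT => nse; apply: nsy; apply/sem_join; exists x; last exact/xe.
  by rewrite mem_filter xs andbT; apply/asboolP => /xe.
Qed.

Lemma le_semW k l (G H : structure L) (a b : node G) (c d : node H) :
  k <= l -> le_sem l a b c d -> le_sem k a b c d.
Proof.
move=> kl le_abcd e /calcP[Fe de]; apply: le_abcd.
by apply/calcP; rewrite Fe (leq_trans de).
Qed.

(* The residual [y / x] in C(F), written through the converse of a right
   residual when [/] itself is missing. *)
Lemma lres_expr k (x y : expr L) :
  has_lres F -> calc F k x -> calc F k y ->
  exists2 z : expr L, calc F k.+1 z &
    forall (G : structure L) (a b : node G),
      sem z a b <-> forall c, sem x b c -> sem y a c.
Proof.
move=> /orP[FR|/andP[FC FR]] /calcP[Fx dx] /calcP[Fy dy].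
  exists (ELres y x) => //.
  by rewrite /calc /= FR Fx Fy ltnS geq_max dx dy.
exists (EConv (ERres (EConv x) (EConv y))) => //.
by rewrite /calc /= FC FR Fx Fy ltnS geq_max dx dy.
Qed.

Lemma rres_expr k (x y : expr L) :
  has_rres F -> calc F k x -> calc F k y ->
  exists2 z : expr L, calc F k.+1 z &
    forall (G : structure L) (a b : node G),
      sem z a b <-> forall c, sem x c a -> sem y c b.
Proof.
move=> /orP[FR|/andP[FC FR]] /calcP[Fx dx] /calcP[Fy dy].
  exists (ERres x y) => //.
  by rewrite /calc /= FR Fx Fy ltnS geq_max dx dy.
exists (EConv (ELres (EConv y) (EConv x))) => //.
by rewrite /calc /= FC FR Fx Fy ltnS geq_max dx dy.
Qed.

Lemma le_sem_forth k (G1 G2 : structure L) (a1 b1 : node G1) (a2 b2 : node G2) :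
  le_sem k.+1 a1 b1 a2 b2 ->
  forth F (@fpaths F L k G1) (@fpaths F L k G2) (@le_sem k G1 G2)
    (qswap (@le_sem k G2 G1)) a1 b1 a2 b2.
Proof.
move=> le12.
have id12 : a1 = b1 -> a2 = b2 by move/(le12 EId); apply.
split.
- move=> c1 P1 P2.
  have [x [cx sx ux]] := upper_expr P1; have [y [cy sy uy]] := upper_expr P2.
  have [||c2 [/ux ? /uy ?]] := le12 (EComp x y); last by exists c2.
    move: cx cy => /calcP[Fx dx] /calcP[Fy dy].
    by apply/calcP; rewrite /= Fx Fy ltnS geq_max dx.
  by exists c1.
- move=> FP; split; last first.
    move=> eab c1 /upper_expr[x [/calcP[Fx dx] sx ux]].
    have [||_ [c2 /ux ?]] := le12 (EProj2 x); last by exists c2.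
      by rewrite /calc /= FP Fx.
    by split=> //; exists c1.
  have [eab|] := EM (a1 = b1); [right|by left]; split; auto.
  move=> c1 /upper_expr[x [/calcP[Fx dx] sx ux]].
  have [||_ [c2 /ux ?]] := le12 (EProj1 x); last by exists c2.
    by rewrite /calc /= FP Fx.
  by split=> //; exists c1.
- move=> FP; split; last first.
    move=> eab c2 /upper_expr[x [/calcP[Fx dx] sx ux]].
    (* If no [c1] matches [c2], then [x] has no pair ending in [a1]. The coprojection carries this
       over to [a2], yet [x] holds at [c2], [a2]. *)
    apply: contrapT => no_c1; have [||_ []] := le12 (ECoproj2 x).
    + by rewrite /calc /= FP Fx.
    + by split=> // -[c1 /ux ?]; apply: no_c1; exists c1.
    + by exists c2.
  have [eab|] := EM (a1 = b1); [right|by left]; split; auto.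
  move=> c2 /upper_expr[x [/calcP[Fx dx] sx ux]].
  apply: contrapT => no_c1; have [||_ []] := le12 (ECoproj1 x).
  + by rewrite /calc /= FP Fx.
  + by split=> // -[c1 /ux ?]; apply: no_c1; exists c1.
  + by exists c2.
- move=> FR c2 /upper_expr[x [cx sx ux]].
  (* The residual [y / x] fails at [a2], [b2], as [c2] shows. Without a matching [c1] it would hold
     at [a1], [b1]: any [c1] with [x] at [b1], [c1] satisfies the [W] part, so [y] must hold at
     [a1], [c1], or else the [Z] part would hold too. *)
  have [y [cy nsy ly]] := lower_expr k a2 c2.
  have [z cz zP] := lres_expr FR cx cy.
  apply: contrapT => no_c1; apply: nsy; apply: (iffLR (zP G2 a2 b2)) sx.
  apply: le12 => //; apply/zP => c1 /ux sx1; apply: contrapT => /ly le_ac.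
  by apply: no_c1; exists c1; split; [|right].
- move=> FR c2 /upper_expr[x [cx sx ux]].
  have [y [cy nsy ly]] := lower_expr k c2 b2.
  have [z cz zP] := rres_expr FR cx cy.
  apply: contrapT => no_c1; apply: nsy; apply: (iffLR (zP G2 a2 b2)) sx.
  apply: le12 => //; apply/zP => c1 /ux sx1; apply: contrapT => /ly le_cb.
  by apply: no_c1; exists c1; split; [|right].
Qed.

Lemma le_sem_atoms k (G1 G2 : structure L) (a1 b1 : node G1) (a2 b2 : node G2) :
  le_sem k a1 b1 a2 b2 -> atoms_forth F a1 b1 a2 b2.
Proof.
move=> le12 e [ae Fe se]; split=> //; apply: le12 => //; apply/calcP.
by split=> //; case: e ae {Fe se} => // -[].
Qed.

Lemma le_sem_simulation k (G1 G2 : structure L) :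
  simulation F k (fun i => @le_sem i G1 G2) (fun i => qswap (@le_sem i G2 G1)).
Proof.
split.
- by move=> i _ a1 b1 a2 b2; apply: le_semW.
- by move=> i _ a1 b1 a2 b2; apply: le_semW.
- by move=> a1 b1 a2 b2; apply: le_sem_atoms.
- by move=> a1 b1 a2 b2; apply: le_sem_atoms.
- by move=> i _ a1 b1 a2 b2; apply: le_sem_forth.
- by move=> i _ a1 b1 a2 b2; apply: le_sem_forth.
Qed.

End Completeness.

Theorem theorem5p4 (L : finType) (F : feature -> bool) (k : nat)
  (G1 G2 : marked L) :
  similar F k G1 G2 <-> sqsubseteq F k G1 G2.
Proof.
split=> [[Z [W [sZW Zk]]] e Fe de|le12].
  by have [] := simulation_sem Fe sZW (leqnn k) de Zk.
exists (fun i => @le_sem L F i G1 G2), (fun i => qswap (@le_sem L F i G2 G1)).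
split; first exact: le_sem_simulation.
by move=> e /calcP[Fe de]; apply: le12.
Qed.
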